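(* Let $\phi:\mathbb{R}^d\to\mathbb{R}$ be a convex quadratic function with Hessian $A\in\mathbb{R}^{d\times d}$, i.e. $\phi(\mathbf{y})=\phi(\mathbf{x})+\langle\nabla\phi(\mathbf{x}),\mathbf{y}-\mathbf{x}\rangle+\frac12\|\mathbf{y}-\mathbf{x}\|_A^2$ for all $\mathbf{x},\mathbf{y}$, with $0\preceq A\preceq L\cdot I$, $L>0$. Assume that $\phi$ is $\mu$-strongly convex, $\mu>0$, i.e. $\phi(\mathbf{y})\ge\phi(\mathbf{x})+\langle\nabla\phi(\mathbf{x}),\mathbf{y}-\mathbf{x}\rangle+\frac{\mu}{2}\|\mathbf{y}-\mathbf{x}\|^2$ for all $\mathbf{x},\mathbf{y}$. Let $f=\phi+\zeta$ with $|f(\mathbf{x})-\phi(\mathbf{x})|\le\sigma$ for all $\mathbf{x}\in\mathbb{R}^d$, where $\sigma\ge0$. Let $\alpha>0$, and for $t=0,\dots,T-1$ let $S_t\in\mathbb{R}^{d\times\ell}$ be a $(\frac14,k,\frac{\delta}{T})$-oblivious sketching matrix for the matrix product, with columns $\mathbf{s}_t^{(1)},\dots,\mathbf{s}_t^{(\ell)}$. Let $\{\mathbf{x}_t\}$ be generated by $$\mathbf{x}_{t+1}=\mathbf{x}_t-\eta\,\mathbf{g}(\mathbf{x}_t),\qquad \mathbf{g}(\mathbf{x}_t)=\sum_{i=1}^{\ell}\frac{f(\mathbf{x}_t+\alpha\mathbf{s}_t^{(i)})-f(\mathbf{x}_t-\alpha\mathbf{s}_t^{(i)})}{2\alpha}\,\mathbf{s}_t^{(i)},$$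 with step size $\eta=\left(5\|A\|_2+\frac{\mathrm{tr}(A)}{k}\right)^{-1}$. Then for each $t$, with probability at least $1-\delta/T$, $$\phi(\mathbf{x}_{t+1})-\phi(\mathbf{x}^* )-\frac{3\ell\sigma^2}{\mu\alpha^2}\le\left(1-\frac{\mu}{4}\left(5\|A\|_2+\frac{\mathrm{tr}(A)}{k}\right)^{-1}\right)\left(\phi(\mathbf{x}_t)-\phi(\mathbf{x}^* )-\frac{3\ell\sigma^2}{\mu\alpha^2}\right),$$ where $\mathbf{x}^*$ is the minimizer of $\phi$.
   Context: Norms: $\|\mathbf{x}\|$ is the Euclidean norm, $\|\mathbf{x}\|_A=\|A^{1/2}\mathbf{x}\|$, $\|\cdot\|_2$ is the spectral norm, $\|\cdot\|_F$ is the Frobenius norm; $B\preceq C$ means $C-B$ is positive semidefinite. Sketching matrix: for $0<\gamma\le1$, $k\ge1$, $\delta>0$, a random matrix $S\in\mathbb{R}^{d\times\ell}$ is an oblivious $(\gamma,k,\delta)$-random sketching matrix for the matrix product if, for any given matrix $B\in\mathbb{R}^{d\times d}$ ($S$ being independent of $B$), with probability at least $1-\delta$, $\|B^\top SS^\top B-B^\top B\|_2\le\gamma\left(\|B\|_2^2+\frac{\|B\|_F^2}{k}\right)$. In the algorithm the matrix $S_t$ is freshly generated at iteration $t$, independently of $\mathbf{x}_t$; $\mathbf{x}_0$ is a given initial vector and $T$ is the number of iterations. *)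

(* Defs.v *)
(* Vectors of R^d are column vectors ['cV[R]_d]. *)
From HB Require Import structures.
From mathcomp Require Export all_boot all_order all_algebra.
From mathcomp Require Export all_classical all_reals all_analysis.
Export Order.TTheory GRing.Theory Num.Theory.
Export numFieldNormedType.Exports.

Set Implicit Arguments.
Unset Strict Implicit.
Unset Printing Implicit Defensive.

Local Open Scope classical_set_scope.
Local Open Scope ring_scope.

Section LinearAlgebra.
Context {R : realType}.

Definition dotp {d : nat} (x y : 'cV[R]_d) : R := \sum_(i < d) x i 0 * y i 0.

(* The library norm [`|x|] on matrices is the sup norm, hence this definition. *)
Definition enorm {d : nat} (x : 'cV[R]_d) : R := Num.sqrt (dotp x x).

Definition spectral_norm {m n : nat} (M : 'M[R]_(m, n)) : R :=
  sup [set enorm (M *m x) | x in [set x : 'cV[R]_n | enorm x <= 1]].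

Definition frobenius_norm {m n : nat} (M : 'M[R]_(m, n)) : R :=
  Num.sqrt (\sum_(i < m) \sum_(j < n) M i j ^+ 2).

Definition psdmx {d : nat} (M : 'M[R]_d) : Prop :=
  M^T = M /\ forall x : 'cV[R]_d, 0 <= dotp x (M *m x).

Definition loewner_le {d : nat} (B C : 'M[R]_d) : Prop := psdmx (C - B).

(* [A^{1/2}]: the positive semidefinite square root, which exists and is unique
   when [psdmx A]; the default value 0 is then never used. *)
Definition sqrtmx {d : nat} (A : 'M[R]_d) : 'M[R]_d :=
  xget 0 [set Q : 'M[R]_d | psdmx Q /\ Q *m Q = A].

Definition mxnorm {d : nat} (A : 'M[R]_d) (x : 'cV[R]_d) : R :=
  enorm (sqrtmx A *m x).

(* The gradient as the vector of partial derivatives. It is only meaningful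
   where [phi] is differentiable; [quadratic_with_hessian] forces this
   everywhere, since its right-hand side is polynomial in [y]. *)
Definition grad {d : nat} (phi : 'cV[R]_d -> R) (x : 'cV[R]_d) : 'cV[R]_d :=
  \col_(i < d) 'D_(delta_mx i 0 : 'cV[R]_d) phi x.

Definition quadratic_with_hessian {d : nat} (phi : 'cV[R]_d -> R)
    (A : 'M[R]_d) : Prop :=
  forall x y : 'cV[R]_d,
    phi y = phi x + dotp (grad phi x) (y - x) + 2^-1 * mxnorm A (y - x) ^+ 2.

Definition strongly_convex {d : nat} (mu : R) (phi : 'cV[R]_d -> R) : Prop :=
  forall x y : 'cV[R]_d,
    phi y >= phi x + dotp (grad phi x) (y - x) + mu / 2 * enorm (y - x) ^+ 2.

Definition grad_estimate {d l : nat} (f : 'cV[R]_d -> R) (alpha : R)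
    (S : 'M[R]_(d, l)) (x : 'cV[R]_d) : 'cV[R]_d :=
  \sum_(i < l)
    ((f (x + alpha *: col i S) - f (x - alpha *: col i S)) / (2 * alpha))
      *: col i S.

End LinearAlgebra.

(* The matrix space with its Borel sigma-algebra (generated by the open sets). *)
Definition borelM (R : realType) (m n : nat) :=
  g_sigma_algebraType (@open 'M[R]_(m, n)).

Section Probability.
Context {disp : measure_display} {Omega : measurableType disp} {R : realType}.
Variable P : probability Omega R.

Definition random_matrix {m n : nat} (X : Omega -> 'M[R]_(m, n)) : Prop :=
  measurable_fun [set: Omega] (X : Omega -> borelM R m n).

Definition independent_matrices {m n p q : nat}
    (X : Omega -> 'M[R]_(m, n)) (Y : Omega -> 'M[R]_(p, q)) : Prop :=
  forall (U : set (borelM R m n)) (V : set (borelM R p q)),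
    measurable U -> measurable V ->
    P (X @^-1` U `&` Y @^-1` V) = (P (X @^-1` U) * P (Y @^-1` V))%E.

(* Obliviousness: the probability bound holds for each fixed [B], the
   distribution of [S] not depending on [B]. *)
Definition oblivious_sketch {d l : nat} (gamma k delta : R)
    (S : Omega -> 'M[R]_(d, l)) : Prop :=
  random_matrix S /\
  forall B : 'M[R]_d,
    ((1 - delta)%:E <=
     P [set w | (spectral_norm (B^T *m S w *m (S w)^T *m B - B^T *m B)
                 <= gamma * (spectral_norm B ^+ 2
                             + frobenius_norm B ^+ 2 / k))%R])%E.

End Probability.

(* Main.v *)
Require Import Defs.
From mathcomp Require Import measurable_realfun ring lra.

Set Implicit Arguments.
Unset Strict Implicit.
Unset Printing Implicit Defensive.

Local Open Scope classical_set_scope.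
Local Open Scope ring_scope.

(** Write [Q] for the square root of [A], [a] for the spectral norm of [A],
    [M = 5 a + tr A / k], so that the step size is [1 / M], and [g] for the
    gradient of [phi] at the current iterate.

    The descent inequality needs two facts about the sketch [S]:
    - it does not blow up the curvature:
      [<S u, A S u> <= (3/4) M |u|^2] for all [u];
    - it does not lose the gradient: [|S^T g|^2 >= |g|^2 / 4].
    Given both, the gradient estimate is [S (S^T g + v)] where the noise
    contributes [|v|^2 <= l sigma^2 / alpha^2], and expanding the quadratic
    [phi] along the step, then using [|g|^2 >= 2 mu (phi x - phi xstar)],
    gives the claim ([sketched_step_descent]).

    Applying the sketching property to [Q] for the first fact and to a rank-one
    matrix built from [g] for the second would cost two events of failure
    probability [delta / T] each. A single event suffices if the test matrix
    [B] satisfies [B B^T = A + h h^T], where [h] is [g] rescaled to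
    [|h|^2 = c = a + tr A / k] (if [g <> 0]). Then [|B|_2^2 <= a + c] and
    [|B|_F^2 = tr A + c], so [B^T (S S^T - 1) B] has norm at most [3 c / 4].
    Every vector [Q w] is some [B v] with [|v| <= |w|], so
    [|S^T Q w|^2 <= (a + 3 c / 4) |w|^2], which is the first fact by
    transposition; and [h = B v] with [|v| <= 1], so
    [|S^T h|^2 >= c - 3 c / 4], which is the second. Since [g] is in the range
    of [Q], there is an explicit such [B], a rank-one perturbation of [Q]
    ([probe], [sketch_quality]).

    The matrix [B] depends on the random iterate. The two facts define a
    measurable set of pairs (iterate, sketch), each section of which over a
    fixed iterate has probability at least [1 - delta / T]; as iterate and
    sketch are independent, their joint law is the product of their laws, and
    Fubini's theorem concludes ([independent_sections]). *)

(** * Euclidean geometry and the spectral norm *)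

Section EuclideanGeometry.
Context {R : realType}.

Lemma dotpC d (x y : 'cV[R]_d) : dotp x y = dotp y x.
Proof. by apply: eq_bigr => i _; rewrite mulrC. Qed.

Lemma dotpDl d (x y z : 'cV[R]_d) : dotp (x + y) z = dotp x z + dotp y z.
Proof. by rewrite -big_split; apply: eq_bigr => i _; rewrite mxE mulrDl. Qed.

Lemma dotpZl d a (x z : 'cV[R]_d) : dotp (a *: x) z = a * dotp x z.
Proof. by rewrite /dotp mulr_sumr; apply: eq_bigr => i _; rewrite mxE mulrA. Qed.

Lemma dotpNl d (x z : 'cV[R]_d) : dotp (- x) z = - dotp x z.
Proof. by rewrite -scaleN1r dotpZl mulN1r. Qed.

Lemma dotpDr d (x y z : 'cV[R]_d) : dotp z (x + y) = dotp z x + dotp z y.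
Proof. by rewrite !(dotpC z) dotpDl. Qed.

Lemma dotpZr d a (x z : 'cV[R]_d) : dotp z (a *: x) = a * dotp z x.
Proof. by rewrite !(dotpC z) dotpZl. Qed.

Lemma dotpNr d (x z : 'cV[R]_d) : dotp z (- x) = - dotp z x.
Proof. by rewrite !(dotpC z) dotpNl. Qed.

Definition dotp_bilin := (dotpDl, dotpDr, dotpNl, dotpNr, dotpZl, dotpZr).

Lemma dotp0l d (x : 'cV[R]_d) : dotp 0 x = 0.
Proof. by rewrite -(scale0r x) dotpZl mul0r. Qed.

Lemma dotp0r d (x : 'cV[R]_d) : dotp x 0 = 0.
Proof. by rewrite dotpC dotp0l. Qed.

Lemma dotp_mulmx m n (M : 'M[R]_(m, n)) x y :
  dotp (M *m x) y = dotp x (M^T *m y).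
Proof.
have dotpE d (u v : 'cV[R]_d) : dotp u v = (u^T *m v) 0 0.
  by rewrite mxE; apply: eq_bigr => i _; rewrite mxE.
by rewrite !dotpE trmx_mul mulmxA.
Qed.

Lemma dotp_ge0 d (x : 'cV[R]_d) : 0 <= dotp x x.
Proof. by apply: sumr_ge0 => i _; rewrite -expr2 sqr_ge0. Qed.

Lemma dotp_eq0 d (x : 'cV[R]_d) : dotp x x = 0 -> x = 0.
Proof.
move=> x0; apply/colP => i; rewrite mxE; apply/eqP.
rewrite -sqrf_eq0 expr2; move/eqP: x0; rewrite psumr_eq0; last first.
  by move=> j _; rewrite -expr2 sqr_ge0.
by move=> /allP/(_ i); rewrite mem_index_enum => /(_ isT).
Qed.

Lemma dotp_cauchy_schwarz d (x y : 'cV[R]_d) :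
  dotp x y ^+ 2 <= dotp x x * dotp y y.
Proof.
have [y0|y0] := eqVneq (dotp y y) 0.
  by rewrite (dotp_eq0 y0) !dotp0r mulr0 expr0n.
have y_gt0 : 0 < dotp y y by rewrite lt_neqAle eq_sym y0 dotp_ge0.
have := dotp_ge0 (dotp y y *: x - dotp x y *: y).
rewrite !dotp_bilin (dotpC y x) => h.
have : 0 <= dotp y y * (dotp x x * dotp y y - dotp x y ^+ 2).
  by apply: le_trans h _; rewrite le_eqVlt; apply/orP; left; apply/eqP; ring.
by rewrite pmulr_rge0// subr_ge0.
Qed.

Lemma enorm_ge0 d (x : 'cV[R]_d) : 0 <= enorm x.
Proof. exact: sqrtr_ge0. Qed.

Lemma sqr_enorm d (x : 'cV[R]_d) : enorm x ^+ 2 = dotp x x.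
Proof. by rewrite sqr_sqrtr// dotp_ge0. Qed.

Lemma enorm_le d e b (x : 'cV[R]_d) (y : 'cV[R]_e) : 0 <= b ->
  (enorm x <= b * enorm y) = (dotp x x <= b ^+ 2 * dotp y y).
Proof.
move=> b0; rewrite -!sqr_enorm -exprMn ler_pXn2r// nnegrE ?enorm_ge0//.
by rewrite mulr_ge0// enorm_ge0.
Qed.

Lemma enormZ d a (x : 'cV[R]_d) : enorm (a *: x) = `|a| * enorm x.
Proof.
by rewrite /enorm !dotp_bilin mulrA -expr2 sqrtrM ?sqr_ge0// sqrtr_sqr.
Qed.

Lemma enorm0 d : enorm (0 : 'cV[R]_d) = 0.
Proof. by rewrite /enorm dotp0l sqrtr0. Qed.

Lemma enorm_eq0 d (x : 'cV[R]_d) : enorm x = 0 -> x = 0.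
Proof. by move=> x0; apply: dotp_eq0; rewrite -sqr_enorm x0 expr0n. Qed.

Lemma frobenius_sqrE m n (M : 'M[R]_(m, n)) :
  frobenius_norm M ^+ 2 = \tr (M *m M^T).
Proof.
rewrite sqr_sqrtr; last first.
  by apply: sumr_ge0 => i _; apply: sumr_ge0 => j _; rewrite sqr_ge0.
by apply: eq_bigr => i _; rewrite mxE; apply: eq_bigr => j _; rewrite mxE expr2.
Qed.

(** A crude bound, which makes the supremum defining the spectral norm finite. *)
Lemma enorm_mulmx_le_frobenius m n (M : 'M[R]_(m, n)) x :
  enorm (M *m x) <= frobenius_norm M * enorm x.
Proof.
rewrite enorm_le ?sqrtr_ge0//.
rewrite sqr_sqrtr; last first.
  by apply: sumr_ge0 => i _; apply: sumr_ge0 => j _; rewrite sqr_ge0.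
rewrite mulr_suml; apply: ler_sum => i _; rewrite -expr2.
suff -> : (M *m x) i 0 = dotp (row i M)^T x.
  apply: le_trans (dotp_cauchy_schwarz _ _) _.
  rewrite le_eqVlt; apply/orP; left; apply/eqP; congr (_ * _).
  by apply: eq_bigr => j _; rewrite !mxE expr2.
by rewrite mxE; apply: eq_bigr => j _; rewrite !mxE.
Qed.

Let unit_image m n (M : 'M[R]_(m, n)) :=
  [set enorm (M *m x) | x in [set x : 'cV[R]_n | enorm x <= 1]].

Lemma unit_image_has_sup m n (M : 'M[R]_(m, n)) : has_sup (unit_image M).
Proof.
split; first by exists (enorm (M *m 0)), 0 => //=; rewrite enorm0.
exists (frobenius_norm M) => _ [x /= x1 <-].
apply: le_trans (enorm_mulmx_le_frobenius _ _) _.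
by rewrite ler_piMr// sqrtr_ge0.
Qed.

Lemma spectral_norm_ge0 m n (M : 'M[R]_(m, n)) : 0 <= spectral_norm M.
Proof.
apply: ub_le_sup; first by have [] := unit_image_has_sup M.
by exists 0 => /=; rewrite ?mulmx0 enorm0.
Qed.

Lemma enorm_mulmx_le m n (M : 'M[R]_(m, n)) x :
  enorm (M *m x) <= spectral_norm M * enorm x.
Proof.
have [/enorm_eq0->|x0] := eqVneq (enorm x) 0.
  by rewrite mulmx0 !enorm0 mulr0.
have x_gt0 : 0 < enorm x by rewrite lt_neqAle eq_sym x0 enorm_ge0.
rewrite -ler_pdivrMr//; apply: ub_le_sup.
  by have [] := unit_image_has_sup M.
have inorm : `|(enorm x)^-1| = (enorm x)^-1 by rewrite ger0_norm// invr_ge0 ltW.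
exists ((enorm x)^-1 *: x) => /=.
  by rewrite enormZ inorm mulVf.
by rewrite -scalemxAr enormZ inorm mulrC.
Qed.

Lemma spectral_norm_le m n (M : 'M[R]_(m, n)) b : 0 <= b ->
  (spectral_norm M <= b) <->
  (forall x, enorm x <= 1 -> enorm (M *m x) <= b).
Proof.
move=> b0; split=> [Mb x x1|Mb].
  apply: le_trans (enorm_mulmx_le M x) _; rewrite -[leRHS]mulr1.
  by rewrite ler_pM// ?spectral_norm_ge0 ?enorm_ge0.
apply: ge_sup; first by have [] := unit_image_has_sup M.
by move=> _ [x /= x1 <-]; exact: Mb.
Qed.

Lemma dotp_mulmx_le_spectral d (M : 'M[R]_d) b x : spectral_norm M <= b ->
  `|dotp x (M *m x)| <= b * dotp x x.
Proof.
move=> Mb; have b0 := le_trans (spectral_norm_ge0 M) Mb.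
rewrite -ler_sqr ?nnegrE ?mulr_ge0 ?dotp_ge0// -normrX ger0_norm ?sqr_ge0//.
apply: le_trans (dotp_cauchy_schwarz _ _) _.
rewrite exprMn [in leRHS]expr2 mulrCA ler_wpM2l ?dotp_ge0//.
by rewrite -enorm_le// (le_trans (enorm_mulmx_le M x))// ler_wpM2r// enorm_ge0.
Qed.

(** With [z = M^T y], the Cauchy-Schwarz inequality gives
    [|z|^4 = <M z, y>^2 <= |M z|^2 |y|^2 <= K |z|^2 |y|^2]; divide by
    [|z|^2]. *)
Lemma sqnorm_trmx_le m n (M : 'M[R]_(m, n)) K : 0 <= K ->
  (forall x, dotp (M *m x) (M *m x) <= K * dotp x x) ->
  forall y, dotp (M^T *m y) (M^T *m y) <= K * dotp y y.
Proof.
move=> K0 MK y; set z := M^T *m y.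
have [z0|z0] := eqVneq (dotp z z) 0; first by rewrite z0 mulr_ge0// dotp_ge0.
have z_gt0 : 0 < dotp z z by rewrite lt_neqAle eq_sym z0 dotp_ge0.
rewrite -(ler_pM2r z_gt0) -expr2.
have {1}-> : dotp z z = dotp (M *m z) y by rewrite dotp_mulmx.
apply: le_trans (dotp_cauchy_schwarz _ _) _.
by rewrite mulrAC ler_wpM2r ?dotp_ge0.
Qed.

Lemma spectral_norm_sqr_le m n (M : 'M[R]_(m, n)) K : 0 <= K ->
  (forall y, dotp (M^T *m y) (M^T *m y) <= K * dotp y y) ->
  spectral_norm M ^+ 2 <= K.
Proof.
move=> K0 MK; rewrite -[leRHS](sqr_sqrtr K0) ler_pXn2r ?nnegrE
  ?spectral_norm_ge0 ?sqrtr_ge0//.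
apply/spectral_norm_le; rewrite ?sqrtr_ge0// => x x1.
have : enorm (M *m x) <= Num.sqrt K * enorm x.
  rewrite enorm_le ?sqrtr_ge0// sqr_sqrtr// -[M in M *m _]trmxK.
  exact: sqnorm_trmx_le.
by move/le_trans; apply; rewrite ler_piMr// sqrtr_ge0.
Qed.

Lemma mulmx_sum_col m n (S : 'M[R]_(m, n)) (w : 'cV[R]_n) :
  S *m w = \sum_i w i 0 *: col i S.
Proof.
apply/colP => i; rewrite mxE summxE; apply: eq_bigr => j _.
by rewrite !mxE mulrC.
Qed.

End EuclideanGeometry.

(** * A test matrix for the curvature and the gradient *)

Section SketchProbe.
Context {R : realType} {d : nat}.
Implicit Types (Q A B : 'M[R]_d) (m v w z : 'cV[R]_d).

Lemma mulmx_outer n (u : 'cV[R]_n) m v : u *m m^T *m v = dotp m v *: u.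
Proof.
rewrite -mulmxA.
have -> : m^T *m v = (dotp m v)%:M.
  rewrite [LHS]mx11_scalar; congr _%:M.
  by rewrite mxE; apply: eq_bigr => i _; rewrite mxE.
by rewrite mul_mx_scalar.
Qed.

Lemma trace_outer v : \tr (v *m v^T) = dotp v v.
Proof.
by apply: eq_bigr => i _; rewrite mxE big_ord1 mxE.
Qed.

Lemma quadratic_le_spectral_norm A v : dotp v (A *m v) <= spectral_norm A * dotp v v.
Proof. exact: le_trans (ler_norm _) (dotp_mulmx_le_spectral v (lexx _)). Qed.

(** The factor to the right of [Q] is the positive square root of [1 + m m^T],
    so that the Gram matrix is [Q Q^T + (Q m) (Q m)^T]. *)
Definition probe Q m : 'M[R]_d :=
  Q *m (1%:M + (1 + Num.sqrt (1 + dotp m m))^-1 *: (m *m m^T)).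

Lemma probe_mulmx Q m v :
  probe Q m *m v =
  Q *m (v + ((1 + Num.sqrt (1 + dotp m m))^-1 * dotp m v) *: m).
Proof.
by rewrite -mulmxA mulmxDl mul1mx -scalemxAl mulmx_outer scalerA.
Qed.

Let sqrt_ge1 m : 1 <= Num.sqrt (1 + dotp m m).
Proof. by rewrite -[leLHS]sqrtr1 ler_wsqrtr// lerDl dotp_ge0. Qed.

Let sqr_sqrt m : Num.sqrt (1 + dotp m m) ^+ 2 = 1 + dotp m m.
Proof. by rewrite sqr_sqrtr// addr_ge0// dotp_ge0. Qed.

Lemma probe_gram Q m :
  probe Q m *m (probe Q m)^T = Q *m Q^T + (Q *m m) *m (Q *m m)^T.
Proof.
rewrite /probe; set t := Num.sqrt _; set s := (1 + t)^-1.
have t1 : 1 <= t := sqrt_ge1 m.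
have t2 : t ^+ 2 = 1 + dotp m m := sqr_sqrt m.
have mmm : m *m m^T *m (m *m m^T) = dotp m m *: (m *m m^T).
  by rewrite mulmxA mulmx_outer scalemxAl.
rewrite trmx_mul mulmxA -(mulmxA Q).
have -> : (1%:M + s *: (m *m m^T)) *m (1%:M + s *: (m *m m^T))^T
        = 1%:M + m *m m^T.
  rewrite linearD/= linearZ/= trmx_mul trmxK trmx1.
  rewrite mulmxDl mul1mx mulmxDr mulmx1 -scalemxAl -scalemxAr mmm !scalerA.
  rewrite -addrA; congr (_ + _); rewrite -!scalerDl -[RHS]scale1r; congr (_ *: _).
  have -> : dotp m m = t ^+ 2 - 1 by rewrite t2; ring.
  by rewrite /s; field; lra.
by rewrite mulmxDr mulmx1 mulmxDl trmx_mul !mulmxA.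
Qed.

(** The preimage of [Q m] is [m / t] with [t = sqrt (1 + |m|^2)]; its squared
    norm is [|m|^2 / (1 + |m|^2)]. *)
Lemma probe_direction Q m : exists2 v, dotp v v <= 1 & probe Q m *m v = Q *m m.
Proof.
have t1 := sqrt_ge1 m; have t2 := sqr_sqrt m; set t := Num.sqrt _ in t1 t2.
exists (t^-1 *: m).
  rewrite !dotp_bilin mulrA -expr2 exprVn t2 mulrC ler_pdivrMr; last first.
    by rewrite ltr_pwDl// dotp_ge0.
  by rewrite mul1r lerDr.
rewrite probe_mulmx -/t dotpZr -scalerDl -scalemxAr -[RHS]scale1r.
congr (_ *: _).
have -> : dotp m m = t ^+ 2 - 1 by rewrite t2; ring.
by field; lra.
Qed.

(** The inverse of the square root of [1 + m m^T] is a contraction, and it maps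
    [w] to the required [v]. *)
Lemma probe_dominates Q m w :
  exists2 v, dotp v v <= dotp w w & probe Q m *m v = Q *m w.
Proof.
have t1 := sqrt_ge1 m; have t2 := sqr_sqrt m; set t := Num.sqrt _ in t1 t2.
have t0 : t != 0 by lra.
have t10 : 1 + t != 0 by lra.
have mm : dotp m m = t ^+ 2 - 1 by rewrite t2; ring.
(* The inverse of [1 + s m m^T] is [1 - (s / t) m m^T] for [s = 1 / (1 + t)]. *)
exists (w - (((1 + t) * t)^-1 * dotp m w) *: m).
  rewrite !dotp_bilin (dotpC w m) mm.
  rewrite [leLHS](_ : _ = dotp w w - (t ^-1 * dotp m w) ^+ 2); last first.
    by field; rewrite t0 t10.
  by rewrite gerBl sqr_ge0.
rewrite probe_mulmx -/t !dotp_bilin mm; congr (_ *m _).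
rewrite -addrA -scaleNr -scalerDl [X in X *: m](_ : _ = 0) ?scale0r ?addr0//.
by field; rewrite t0 t10.
Qed.

Lemma probe_spectral Q m :
  Q^T = Q -> spectral_norm (probe Q m) ^+ 2 <=
    spectral_norm (Q *m Q) + dotp (Q *m m) (Q *m m).
Proof.
move=> QT; apply: spectral_norm_sqr_le.
  by rewrite addr_ge0 ?spectral_norm_ge0 ?dotp_ge0.
move=> y; rewrite dotp_mulmx trmxK mulmxA probe_gram QT mulmxDl mulmx_outer.
rewrite dotpDr dotpZr mulrDl lerD ?quadratic_le_spectral_norm//.
by rewrite (dotpC y) -expr2 dotp_cauchy_schwarz.
Qed.

Lemma probe_frobenius Q m : Q^T = Q ->
  frobenius_norm (probe Q m) ^+ 2 = \tr (Q *m Q) + dotp (Q *m m) (Q *m m).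
Proof.
by move=> QT; rewrite frobenius_sqrE probe_gram QT linearD/= trace_outer.
Qed.

Lemma sketch_form l B (S : 'M[R]_(d, l)) theta :
  spectral_norm (B^T *m S *m S^T *m B - B^T *m B) <= theta ->
  forall v, `|dotp (S^T *m (B *m v)) (S^T *m (B *m v)) - dotp (B *m v) (B *m v)|
            <= theta * dotp v v.
Proof.
move=> hS v; apply: le_trans (dotp_mulmx_le_spectral v hS).
rewrite le_eqVlt; apply/orP; left; apply/eqP; congr `|_|.
rewrite mulmxBl dotpDr dotpNr !(dotp_mulmx S^T) !(dotp_mulmx B) trmxK.
by rewrite !mulmxA.
Qed.

(** One sketching event, for the test matrix [probe Q m] with [Q m] the
    rescaled gradient, controls both the curvature along the sketch and the
    part of the gradient [Q *m Q *m z] that the sketch retains. *)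
Lemma sketch_quality l Q k z : Q^T = Q -> 1 <= k ->
  exists B, forall S : 'M[R]_(d, l),
    spectral_norm (B^T *m S *m S^T *m B - B^T *m B)
      <= 1 / 4 * (spectral_norm B ^+ 2 + frobenius_norm B ^+ 2 / k) ->
    (forall u, dotp (S *m u) (Q *m Q *m (S *m u)) <=
       3 / 4 * (5 * spectral_norm (Q *m Q) + \tr (Q *m Q) / k) * dotp u u) /\
    1 / 4 * dotp (Q *m Q *m z) (Q *m Q *m z) <=
      dotp (S^T *m (Q *m Q *m z)) (S^T *m (Q *m Q *m z)).
Proof.
move=> QT k1; have k0 : 0 < k by lra.
set A := Q *m Q; set a := spectral_norm A; set g := A *m z.
have a0 : 0 <= a by exact: spectral_norm_ge0.
have QQ v : dotp (Q *m v) (Q *m v) = dotp v (A *m v).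
  by rewrite dotp_mulmx QT mulmxA.
have tr0 : 0 <= \tr A.
  rewrite /A -{2}QT -frobenius_sqrE; exact: sqr_ge0.
set tau := \tr A / k; have tau0 : 0 <= tau by rewrite divr_ge0// ltW.
pose c := a + tau; have c0 : 0 <= c by rewrite addr_ge0.
(* If [g] vanishes then so does [r], and the test matrix is [Q]. *)
pose r := Num.sqrt (c / dotp g g).
have r2 : r ^+ 2 = c / dotp g g by rewrite sqr_sqrtr// divr_ge0// dotp_ge0.
pose m := r *: (Q *m z).
have Qm : Q *m m = r *: g by rewrite /m -scalemxAr mulmxA.
set q := dotp (Q *m m) (Q *m m).
have qc : q <= c.
  rewrite /q Qm !dotp_bilin mulrA -expr2 r2.
  by have [->|g0] := eqVneq (dotp g g) 0; rewrite ?mulr0// divfK.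
exists (probe Q m) => S hS.
have {}hS : spectral_norm ((probe Q m)^T *m S *m S^T *m probe Q m
                - (probe Q m)^T *m probe Q m) <= 3 / 4 * c.
  (* The squared norms of the test matrix are at most [a + c] and [tr A + c],
     and [c / k <= c], so the bound is [(a + c + tau + c) / 4 = 3 c / 4]. *)
  apply: le_trans hS _.
  have := probe_spectral m QT; rewrite probe_frobenius// -/A -/a -/q => hB.
  have hq : (\tr A + q) / k <= tau + c.
    rewrite mulrDl lerD2l ler_pdivrMr//; nra.
  by rewrite /c in hq qc *; lra.
have {hS}form := sketch_form hS.
split=> [u|].
  have QS v : dotp (S^T *m (Q *m v)) (S^T *m (Q *m v))
      <= 3 / 4 * (5 * a + tau) * dotp v v.
    have [w wv Bw] := probe_dominates Q m v.
    have := form w; rewrite Bw => /ler_normlW.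
    rewrite QQ; have := quadratic_le_spectral_norm A v; rewrite -/a.
    have := dotp_ge0 v; have := dotp_ge0 w; rewrite /c; nra.
  have K0 : 0 <= 3 / 4 * (5 * a + tau) by lra.
  have := @sqnorm_trmx_le _ _ _ (S^T *m Q) _ K0 _ u.
  rewrite trmx_mul trmxK QT -mulmxA QQ; apply=> v.
  by rewrite -mulmxA.
have [g0|g0] := eqVneq (dotp g g) 0; first by rewrite g0 mulr0 dotp_ge0.
have [v v1 Bv] := probe_direction Q m.
have := form v; rewrite Bv Qm -scalemxAr => /ler_normlP[+ _].
have g_gt0 : 0 < dotp g g by rewrite lt_neqAle eq_sym g0 dotp_ge0.
have c_gt0 : 0 < c.
  suff a_gt0 : 0 < a by rewrite /c; lra.
  rewrite lt_neqAle a0 andbT eq_sym; apply: contra_neq g0 => a_eq0.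
  apply/eqP; rewrite eq_le dotp_ge0 andbT.
  have := enorm_mulmx_le A z; rewrite enorm_le// -/a a_eq0 expr0n mul0r; exact.
rewrite !dotp_bilin !mulrA -expr2 r2.
set p := c / dotp g g => h; have p0 : 0 < p by rewrite divr_gt0.
have cp : c = p * dotp g g by rewrite divfK.
rewrite -(ler_pM2l p0); nra.
Qed.

End SketchProbe.

(** * Strongly convex quadratics and one noisy sketched step *)

Section StronglyConvexQuadratic.
Context {R : realType} {d : nat}.
Variables (phi : 'cV[R]_d -> R) (A : 'M[R]_d) (mu : R).
Hypotheses (hquad : quadratic_with_hessian phi A)
  (hmu : 0 < mu) (hsc : strongly_convex mu phi).

(** If [A] had no positive semidefinite square root, [sqrtmx A] would be [0]
    and [phi] affine, which strong convexity allows only in dimension 0, where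
    [0] is a square root of [A]. *)
Lemma sqrtmx_of_strongly_convex :
  psdmx (sqrtmx A) /\ sqrtmx A *m sqrtmx A = A.
Proof.
rewrite /sqrtmx; case: xgetP => [Q _ //|noQ].
have vec0 (z : 'cV[R]_d) : z = 0.
  apply: dotp_eq0; apply/eqP; rewrite eq_le dotp_ge0 andbT.
  have := hsc 0 z; rewrite (hquad 0 z) -sqr_enorm subr0.
  rewrite /mxnorm /sqrtmx xgetPN// mul0mx enorm0 expr0n mulr0.
  by rewrite addr0 gerDl pmulr_rle0// divr_gt0.
have A0 : A = 0.
  by apply/matrixP => i j; move/colP/(_ i): (vec0 (col j A)); rewrite !mxE.
split; last by rewrite mul0mx A0.
by split=> [|z]; rewrite ?trmx0// mul0mx dotp0r.
Qed.

Lemma sqrtmx_sym : (sqrtmx A)^T = sqrtmx A.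
Proof. by have [[]] := sqrtmx_of_strongly_convex. Qed.

Lemma sqr_sqrtmx : sqrtmx A *m sqrtmx A = A.
Proof. by have [] := sqrtmx_of_strongly_convex. Qed.

Lemma hessian_sym : A^T = A.
Proof. by rewrite -sqr_sqrtmx trmx_mul sqrtmx_sym. Qed.

Lemma mxnorm_sqrE z : mxnorm A z ^+ 2 = dotp z (A *m z).
Proof. by rewrite sqr_enorm dotp_mulmx sqrtmx_sym mulmxA sqr_sqrtmx. Qed.

Lemma quadratic_expansion x z :
  phi (x + z) = phi x + dotp (grad phi x) z + 2^-1 * dotp z (A *m z).
Proof. by rewrite (hquad x (x + z)) [x + z]addrC addrK mxnorm_sqrE. Qed.

Variable xstar : 'cV[R]_d.
Hypothesis hxstar : forall y, phi xstar <= phi y.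

Lemma grad_minimizer : grad phi xstar = 0.
Proof.
set g := grad phi xstar; apply: dotp_eq0.
set h := dotp g (A *m g).
have h0 : 0 <= h by rewrite /h -mxnorm_sqrE sqr_ge0.
(* Minimality is tested against the step [- q i g], along which [phi] would
   change by a negative multiple of [q ^+ 2]. *)
set q := dotp g g; have q0 : 0 <= q := dotp_ge0 g.
set i := (h + 1)^-1; have i0 : 0 < i by rewrite invr_gt0; lra.
have ih : i * (h + 1) = 1 by rewrite mulVf//; lra.
have := hxstar (xstar + (- (q * i)) *: g).
rewrite quadratic_expansion -/g -scalemxAr !dotp_bilin -/h -/q => hmin.
have : q ^+ 2 * (i * (i * h / 2 - 1)) >= 0 by nra.
have hneg : i * (i * h / 2 - 1) < 0 by nra.
rewrite nmulr_lge0// => q2; apply/eqP.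
by rewrite -sqrf_eq0 eq_le q2 sqr_ge0.
Qed.

Lemma quadratic_gap x :
  phi x - phi xstar = 2^-1 * dotp (x - xstar) (A *m (x - xstar)).
Proof.
have := quadratic_expansion xstar (x - xstar).
by rewrite grad_minimizer dotp0l addr0 [_ + (x - _)]addrC subrK => ->; ring.
Qed.

(** Comparing the expansion of [phi] around [x] with the one around its
    minimizer identifies the linear term. *)
Lemma gradE x : grad phi x = A *m (x - xstar).
Proof.
suff h z : dotp (grad phi x) z = dotp (A *m (x - xstar)) z.
  apply/eqP; rewrite -subr_eq0; apply/eqP/dotp_eq0.
  by rewrite dotpDl dotpNl h subrr.
have := quadratic_expansion x z; have := quadratic_gap (x + z).
have := quadratic_gap x; rewrite [x + z - _]addrAC.
move: (x - xstar) => e; rewrite mulmxDr !dotp_bilin.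
rewrite (dotpC z (A *m e)) -[in dotp e (A *m z)]hessian_sym -dotp_mulmx.
lra.
Qed.

(** Strong convexity at [x] towards [xstar] bounds the gap by
    [- <g, e> - (mu / 2) |e|^2], whose maximum over [e] is
    [|g|^2 / (2 mu)]. *)
Lemma gradient_dominance x :
  2 * mu * (phi x - phi xstar) <= dotp (grad phi x) (grad phi x).
Proof.
have := hsc x xstar; rewrite sqr_enorm.
have := dotp_ge0 (grad phi x + mu *: (xstar - x)).
move: (grad phi x) (xstar - x) => g e; rewrite !dotp_bilin (dotpC e g).
have mu0 := hmu; nra.
Qed.

Section SketchedStep.
Variables (l : nat) (f : 'cV[R]_d -> R) (sigma alpha M : R).
Hypotheses (hnoise : forall y, `|f y - phi y| <= sigma) (halpha : 0 < alpha).

(** On the quadratic part the central differences are exact, so they give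
    [S^T grad phi x]; each of the [l] remaining differences is at most
    [2 sigma / (2 alpha)]. *)
Lemma grad_estimate_noise (S : 'M[R]_(d, l)) x :
  exists v : 'cV[R]_l,
    grad_estimate f alpha S x = S *m (S^T *m grad phi x + v) /\
    dotp v v <= l%:R * (sigma / alpha) ^+ 2.
Proof.
pose e y := f y - phi y.
pose v : 'cV[R]_l := \col_i
  ((e (x + alpha *: col i S) - e (x - alpha *: col i S)) / (2 * alpha)).
exists v; split.
  rewrite mulmx_sum_col.
  apply: eq_bigr => i _; congr (_ *: _); rewrite !mxE.
  have -> : \sum_j S^T i j * grad phi x j 0 = dotp (grad phi x) (col i S).
    by apply: eq_bigr => j _; rewrite !mxE mulrC.
  rewrite /e (quadratic_expansion x) -scaleNr (quadratic_expansion x).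
  by rewrite -!scalemxAr !dotp_bilin; field; rewrite gt_eqF.
have sigma0 : 0 <= sigma := le_trans (normr_ge0 _) (hnoise 0).
have alpha2 : 0 < 2 * alpha by rewrite mulr_gt0.
rewrite mulr_natl -[X in _ *+ X]card_ord -sumr_const; apply: ler_sum => i _.
rewrite mxE -expr2 -[leLHS]real_normK ?num_real//.
rewrite ler_pXn2r ?nnegrE ?divr_ge0 ?(ltW halpha)//.
rewrite normrM normfV [ `|2 * _|]gtr0_norm// ler_pdivrMr//.
rewrite [leRHS](_ : _ = sigma + sigma); last by field; rewrite gt_eqF.
by rewrite (le_trans (ler_normB _ _))// lerD// hnoise.
Qed.

Hypothesis hM : 0 < M.

(** Put [a = S^T grad phi x] and let [v] be the noise. The step decreases [phi]
    by at least [(1/M) (<a, a + v> - (3/8) |a + v|^2)], and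
    [<a, a + v> - (3/8) |a + v|^2 =
     |a|^2 / 2 + |a + v|^2 / 8 + |v|^2 / 4 - (3/4) |v|^2]. *)
Lemma sketched_step_descent (S : 'M[R]_(d, l)) x :
  (forall u, dotp (S *m u) (A *m (S *m u)) <= 3 / 4 * M * dotp u u) ->
  1 / 4 * dotp (grad phi x) (grad phi x) <=
    dotp (S^T *m grad phi x) (S^T *m grad phi x) ->
  phi (x - M^-1 *: grad_estimate f alpha S x) - phi xstar
    - 3 * l%:R * sigma ^+ 2 / (mu * alpha ^+ 2) <=
  (1 - mu / 4 * M^-1) *
    (phi x - phi xstar - 3 * l%:R * sigma ^+ 2 / (mu * alpha ^+ 2)).
Proof.
move=> hS hgrad; have [v [-> hv]] := grad_estimate_noise S x.
rewrite -scaleNr quadratic_expansion -scalemxAr !dotp_bilin.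
set a := S^T *m grad phi x in hgrad *.
have -> : dotp (grad phi x) (S *m (a + v)) = dotp a (a + v).
  by rewrite /a dotp_mulmx trmxK.
have := hS (a + v); set N := dotp (S *m _) _.
have := dotp_ge0 (a + v); rewrite !dotp_bilin (dotpC v a).
have := dotp_ge0 v; have := gradient_dominance x.
set D := phi x - phi xstar.
set i := M^-1; have i0 : 0 < i by rewrite invr_gt0.
have iM : i * M = 1 by rewrite mulVf// gt_eqF.
have mu0 := hmu; rewrite [_ + _ - phi xstar]addrAC [_ + _ - phi xstar]addrAC -/D.
have -> : 3 * l%:R * sigma ^+ 2 / (mu * alpha ^+ 2)
    = 3 / mu * (l%:R * (sigma / alpha) ^+ 2).
  by field; rewrite !gt_eqF.
move: hv; set E := l%:R * _ => hv.
have -> : (1 - mu / 4 * i) * (D - 3 / mu * E)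
    = D - 3 / mu * E - i * (mu / 4 * D - 3 / 4 * E).
  by field; rewrite gt_eqF.
move: hgrad; set gg := dotp (grad phi x) _; set aa := dotp a a.
set av := dotp a v; set vv := dotp v v in hv * => hgrad hD vv0 uu0 hN.
have {hN} hiN : i * N <= 3 / 4 * (aa + av + (av + vv)).
  have -> : 3 / 4 * (aa + av + (av + vv)) = i * (3 / 4 * M * (aa + av + (av + vv))).
    transitivity (i * M * (3 / 4 * (aa + av + (av + vv)))); last by ring.
    by rewrite iM mul1r.
  by rewrite ler_pM2l.
rewrite -subr_ge0 [leRHS](_ : _ =
  i * (aa + av - 2^-1 * (i * N) - (mu / 4 * D - 3 / 4 * E))); last by ring.
by apply: mulr_ge0; [exact: ltW | lra].
Qed.

End SketchedStep.

End StronglyConvexQuadratic.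

(** * Continuity and measurability of polynomial matrix expressions *)

(** Continuity and measurability of the matrix expressions below follow from
    the same closure properties, so both are derived from this interface. *)
Definition function_algebra {R : realType} {T : Type} (C : (T -> R) -> Prop) :=
  [/\ forall c, C (fun=> c),
      forall f g, C f -> C g -> C (fun t => f t + g t) &
      forall f g, C f -> C g -> C (fun t => f t * g t)].

Section Entrywise.
Context {R : realType} {T : Type} (C : (T -> R) -> Prop).
Hypothesis algC : function_algebra C.

Definition entrywise m n (F : T -> 'M[R]_(m, n)) :=
  forall i j, C (fun t => F t i j).

Let C_cst c : C (fun=> c). Proof. by case: algC. Qed.

Let C_add f g : C f -> C g -> C (fun t => f t + g t).
Proof. by case: algC => _ + _; apply. Qed.

Let C_mul f g : C f -> C g -> C (fun t => f t * g t).
Proof. by case: algC => _ _; apply. Qed.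

Lemma entrywise_cst m n (M : 'M[R]_(m, n)) : entrywise (fun=> M).
Proof. by move=> i j; exact: C_cst. Qed.

Lemma function_algebra_sum n (h : 'I_n -> T -> R) :
  (forall i, C (h i)) -> C (fun t => \sum_i h i t).
Proof.
move=> Ch; rewrite /index_enum; elim: (Finite.enum _) => [|i s IH].
  by under eq_fun do rewrite big_nil; exact: C_cst.
by under eq_fun do rewrite big_cons; exact: C_add.
Qed.

Lemma entrywise_mul m n p (F : T -> 'M[R]_(m, n)) (G : T -> 'M[R]_(n, p)) :
  entrywise F -> entrywise G -> entrywise (fun t => F t *m G t).
Proof.
move=> CF CG i j; under eq_fun do rewrite mxE.
by apply: function_algebra_sum => k; exact: C_mul.
Qed.

Lemma entrywise_sub m n (F G : T -> 'M[R]_(m, n)) :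
  entrywise F -> entrywise G -> entrywise (fun t => F t - G t).
Proof.
move=> CF CG i j; under eq_fun do rewrite !mxE -mulN1r.
by apply: C_add => //; exact: C_mul.
Qed.

Lemma entrywise_trmx m n (F : T -> 'M[R]_(m, n)) :
  entrywise F -> entrywise (fun t => (F t)^T).
Proof. by move=> CF i j; under eq_fun do rewrite mxE; exact: CF. Qed.

Lemma entrywise_dotp n (F G : T -> 'cV[R]_n) :
  entrywise F -> entrywise G -> C (fun t => dotp (F t) (G t)).
Proof. by move=> CF CG; apply: function_algebra_sum => k; exact: C_mul. Qed.

End Entrywise.

Section BorelMatrices.
Context {R : realType} {m n : nat}.

Lemma closed_measurable_borelM (U : set 'M[R]_(m, n)) :
  closed U -> measurable (U : set (borelM R m n)).
Proof.
move=> /closed_openC oU; rewrite -[U]setCK; apply: measurableC.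
exact: sub_sigma_algebra.
Qed.

Lemma measurable_entry i j :
  measurable_fun [set: borelM R m n] (fun M : borelM R m n => @fun_of_matrix R m n M i j).
Proof.
apply: (measurability _ (RGenOpens.measurableE R)) => _ [_ [a [b ->] <-]].
rewrite setTI; apply: sub_sigma_algebra.
have /continuousP := @coord_continuous R m n i j; apply.
exact: interval_open.
Qed.

End BorelMatrices.

Lemma measurable_function_algebra (R : realType) disp
    (T : measurableType disp) :
  function_algebra (fun f : T -> R => measurable_fun [set: T] f).
Proof.
split=> [c|f g mf mg|f g mf mg] /=; first exact: measurable_cst.
- exact: measurable_funD.
- exact: measurable_funM.
Qed.

Lemma continuous_function_algebra (R : realType) (T : topologicalType) :
  function_algebra (fun f : T -> R => continuous f).
Proof.
split=> [c|f g cf cg|f g cf cg] /= t; first exact: cst_continuous.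
- by apply: cvgD; [exact: cf|exact: cg].
- by apply: cvgM; [exact: cf|exact: cg].
Qed.

Lemma entries_continuous (R : realType) m n :
  entrywise (fun f : 'M[R]_(m, n) -> R => continuous f) id.
Proof. by move=> i j; exact: coord_continuous. Qed.

Lemma continuous_dotp (R : realType) (T : topologicalType) n
    (F G : T -> 'cV[R]_n) :
  entrywise (fun f : T -> R => continuous f) F ->
  entrywise (fun f : T -> R => continuous f) G ->
  continuous (fun t => dotp (F t) (G t)).
Proof. exact: (entrywise_dotp (continuous_function_algebra R T)). Qed.

Lemma random_matrix_entrywise (R : realType) disp (T : measurableType disp)
    m n (X : T -> 'M[R]_(m, n)) :
  measurable_fun [set: T] (X : T -> borelM R m n) ->
  entrywise (fun f : T -> R => measurable_fun [set: T] f) X.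
Proof. by move=> mX i j; exact: (measurableT_comp (measurable_entry i j) mX). Qed.

Lemma measurable_preimage disp disp' (T : measurableType disp)
    (T' : measurableType disp') (h : T -> T') (U : set T') :
  measurable_fun [set: T] h -> measurable U -> measurable (h @^-1` U).
Proof. by move=> mh mU; rewrite -[X in measurable X]setTI; exact: mh. Qed.

Lemma closed_le_fun (R : realType) (T : topologicalType) (f g : T -> R) :
  continuous f -> continuous g -> closed [set x | f x <= g x].
Proof.
move=> cf cg.
have -> : [set x | f x <= g x] = (fun x => g x - f x) @^-1` [set y | 0 <= y].
  by apply/seteqP; split=> x /=; rewrite subr_ge0.
apply: closed_comp; last exact: closed_ge.
by move=> x _; apply: cvgB; [exact: cg|exact: cf].
Qed.

Section ClosedMatrixSets.
Context {R : realType} {d l : nat}.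

(** The spectral norm is a supremum over the unit ball, so the set is an
    intersection of closed sets, one for each vector of the ball. *)
Lemma spectral_le_measurable (B : 'M[R]_d) b : measurable
  [set S : borelM R d l |
    spectral_norm (B^T *m S *m S^T *m B - B^T *m B) <= b].
Proof.
have [b0|b0] := leP 0 b; last first.
  rewrite (_ : [set _ | _] = set0); first exact: measurable0.
  apply/seteqP; split=> // S /= /(le_trans (spectral_norm_ge0 _)).
  by rewrite leNgt b0.
apply: closed_measurable_borelM.
rewrite (_ : mkset _ = \bigcap_(x in [set x | enorm x <= 1]) [set S : 'M[R]_(d, l) |
   dotp ((B^T *m S *m S^T *m B - B^T *m B) *m x)
        ((B^T *m S *m S^T *m B - B^T *m B) *m x) <= b ^+ 2]); last first.
  apply/seteqP; split=> S /=.
    move=> /(spectral_norm_le _ b0) h x /= /h.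
    by rewrite -sqr_enorm ler_pXn2r// nnegrE// enorm_ge0.
  move=> h; apply/(spectral_norm_le _ b0) => x /h /=.
  by rewrite -sqr_enorm ler_pXn2r// nnegrE// enorm_ge0.
apply: closed_bigI => x _; apply: closed_le_fun; last exact: cst_continuous.
suff : entrywise (fun f : 'M[R]_(d, l) -> R => continuous f)
    (fun S => (B^T *m S *m S^T *m B - B^T *m B) *m x).
  by move=> cF; exact: (continuous_dotp cF cF).
have aC := continuous_function_algebra R 'M[R]_(d, l).
have cst n p (M : 'M[R]_(n, p)) := entrywise_cst aC M.
have cS := @entries_continuous R d l.
by do !(apply: entrywise_mul || apply: entrywise_sub || apply: entrywise_trmx).
Qed.

Lemma quadratic_le_measurable (A : 'M[R]_d) K : measurable
  [set S : borelM R d l |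
    forall u, dotp (S *m u) (A *m (S *m u)) <= K * dotp u u].
Proof.
apply: closed_measurable_borelM.
rewrite (_ : mkset _ = \bigcap_u [set S : 'M[R]_(d, l) |
    dotp (S *m u) (A *m (S *m u)) <= K * dotp u u]); last first.
  by apply/seteqP; split=> S /= h u; [move=> _|]; exact: h.
apply: closed_bigI => u _; apply: closed_le_fun; last exact: cst_continuous.
have aC := continuous_function_algebra R 'M[R]_(d, l).
have cst n p (M : 'M[R]_(n, p)) := entrywise_cst aC M.
have cS := @entries_continuous R d l.
have cSu := entrywise_mul aC cS (cst _ _ u).
exact: (continuous_dotp cSu (entrywise_mul aC (cst _ _ A) cSu)).
Qed.

End ClosedMatrixSets.

(** * Conditioning on an independent variable *)

Section Independence.
Local Open Scope ereal_scope.
Context {disp d1 d2 : measure_display} {Omega : measurableType disp}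
  {T1 : measurableType d1} {T2 : measurableType d2} {R : realType}.
Variable P : probability Omega R.

(** By independence the joint law is a product measure, so the probability of
    [G] is the mean over [X] of the probabilities of its sections. *)
Lemma independent_sections (X : Omega -> T1) (Y : Omega -> T2) (c : \bar R)
    (G : set (T1 * T2)) :
  measurable_fun [set: Omega] X -> measurable_fun [set: Omega] Y ->
  (forall U V, measurable U -> measurable V ->
     P (X @^-1` U `&` Y @^-1` V) = P (X @^-1` U) * P (Y @^-1` V)) ->
  measurable G ->
  (forall x, c <= P [set w | G (x, Y w)]) ->
  c <= P [set w | G (X w, Y w)].
Proof.
move=> mX mY indep mG hG.
have mXY : measurable_fun [set: Omega] (fun w => (X w, Y w)).
  exact: measurable_fun_pair.
have [c0|c0] := leP c 0; first exact: le_trans c0 (measure_ge0 _ _).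
pose muX := distribution P (mfun_Sub (mem_set mX)).
pose muY := distribution P (mfun_Sub (mem_set mY)).
pose muXY := distribution P (mfun_Sub (mem_set mXY)).
have <- : (muX \x muY) G = P [set w | G (X w, Y w)].
  exact: (product_measure_unique (m' := muXY)).
rewrite -[c]mule1 -(probability_setT muX) -integral_cst//.
apply: ge0_le_integral => //.
- by move=> x _; rewrite ltW.
- exact: measurable_fun_xsection.
- move=> x _ /=; apply: le_trans (hG x) _.
  by rewrite /muY /distribution /pushforward /= xsectionE.
Qed.

End Independence.

(** * The convergence bound *)

(** The iterates and sketches to which [sketched_step_descent] applies; the
    gradient is in its linear form, which is visibly measurable. *)
Definition good_sketch {R : realType} {d l : nat} (A : 'M[R]_d) (K : R)
    (xstar : 'cV[R]_d) : set (borelM R d 1 * borelM R d l) :=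
  [set z : 'cV[R]_d * 'M[R]_(d, l) |
    (forall u, dotp (z.2 *m u) (A *m (z.2 *m u)) <= K * dotp u u) /\
    1 / 4 * dotp (A *m (z.1 - xstar)) (A *m (z.1 - xstar)) <=
      dotp (z.2^T *m (A *m (z.1 - xstar))) (z.2^T *m (A *m (z.1 - xstar)))].

Lemma good_sketch_measurable (R : realType) d l (A : 'M[R]_d) K xstar :
  measurable (@good_sketch R d l A K xstar).
Proof.
apply: (@measurableI _ _ [set z : borelM R d 1 * borelM R d l |
  forall u, dotp (z.2 *m u) (A *m (z.2 *m u)) <= K * dotp u u]).
  exact: (measurable_preimage (@measurable_snd _ _ (borelM R d 1) (borelM R d l))
    (quadratic_le_measurable A K)).
rewrite -[X in measurable X]setTI.
pose T : measurableType _ := (borelM R d 1 * borelM R d l)%type.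
have aC := measurable_function_algebra R T.
have cst n p (M : 'M[R]_(n, p)) := entrywise_cst aC M.
have c1 := random_matrix_entrywise (@measurable_fst _ _ (borelM R d 1) (borelM R d l)).
have c2 := random_matrix_entrywise (@measurable_snd _ _ (borelM R d 1) (borelM R d l)).
have cg := entrywise_mul aC (cst _ _ A) (entrywise_sub aC c1 (cst _ _ xstar)).
have cSg := entrywise_mul aC (entrywise_trmx c2) cg.
apply: (@measurable_fun_le _ T R) => //.
  apply: measurable_funM; first exact: measurable_cst.
  exact: (entrywise_dotp aC cg cg).
exact: (entrywise_dotp aC cSg cSg).
Qed.

Theorem theorem1
  (disp : measure_display) (Omega : measurableType disp) (R : realType)
  (P : probability Omega R)
  (d l T : nat)
  (phi f zeta : 'cV[R]_d -> R) (A : 'M[R]_d)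
  (L mu sigma alpha k delta eta : R)
  (S : nat -> Omega -> 'M[R]_(d, l))
  (x : nat -> Omega -> 'cV[R]_d) (x0 xstar : 'cV[R]_d)
  (hquad : quadratic_with_hessian phi A)
  (hL : 0 < L) (hA0 : loewner_le 0 A) (hAL : loewner_le A (L *: 1%:M))
  (hmu : 0 < mu) (hsc : strongly_convex mu phi)
  (hf : forall y, f y = phi y + zeta y)
  (hsigma : 0 <= sigma) (hnoise : forall y, `|f y - phi y| <= sigma)
  (halpha : 0 < alpha) (hk : 1 <= k) (hdelta : 0 < delta)
  (hS : forall t, (t < T)%N -> oblivious_sketch P (1 / 4) k (delta / T%:R) (S t))
  (hx : forall t, (t <= T)%N -> random_matrix (x t))
  (hindep : forall t, (t < T)%N -> independent_matrices P (S t) (x t))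
  (heta : eta = (5 * spectral_norm A + \tr A / k)^-1)
  (hx0 : forall w, x 0%N w = x0)
  (hstep : forall t, (t < T)%N -> forall w,
     x t.+1 w = x t w - eta *: grad_estimate f alpha (S t w) (x t w))
  (hxstar : forall y, phi xstar <= phi y) :
  forall t, (t < T)%N ->
  ((1 - delta / T%:R)%:E <=
   P [set w |
      (phi (x t.+1 w) - phi xstar - 3 * l%:R * sigma ^+ 2 / (mu * alpha ^+ 2)
      <= (1 - mu / 4 * (5 * spectral_norm A + \tr A / k)^-1)
         * (phi (x t w) - phi xstar
            - 3 * l%:R * sigma ^+ 2 / (mu * alpha ^+ 2)))%R])%E.
Proof.
move=> t tT; set M := 5 * spectral_norm A + \tr A / k in heta *.
set N := 3 * _ * _ / _.
have [mS hB] := hS t tT; have mx := hx t (ltnW tT); have mx' := hx t.+1 tT.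
have QT := sqrtmx_sym hquad hmu hsc; have QQ := sqr_sqrtmx hquad hmu hsc.
have M0 : 0 <= M.
  apply: addr_ge0; first by rewrite mulr_ge0 ?spectral_norm_ge0.
  by rewrite -QQ -{2}QT -frobenius_sqrE divr_ge0 ?sqr_ge0//; lra.
have mgap (X : Omega -> 'cV[R]_d) : random_matrix X ->
    measurable_fun [set: Omega] (fun w => phi (X w) - phi xstar).
  move=> mX; under eq_fun do rewrite (quadratic_gap hquad hmu hsc hxstar).
  have aC := measurable_function_algebra R Omega.
  have c1 := entrywise_sub aC (random_matrix_entrywise mX) (entrywise_cst aC xstar).
  have c2 := entrywise_mul aC (entrywise_cst aC A) c1.
  apply: measurable_funM; first exact: measurable_cst.
  exact: (entrywise_dotp aC c1 c2).
set E := mkset _.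
have mE : measurable E.
  rewrite -[E]setTI; apply: measurable_fun_le => //.
    by apply: measurable_funB; [exact: mgap|exact: measurable_cst].
  apply: measurable_funM; first exact: measurable_cst.
  by apply: measurable_funB; [exact: mgap|exact: measurable_cst].
(* [M] vanishes only in dimension 0; the step size is then 0 too. *)
have [M_eq0|M_neq0] := eqVneq M 0.
  suff -> : E = setT.
    by rewrite probability_setT lee_fin gerBl divr_ge0// ltW.
  apply/seteqP; split=> // w _; rewrite /E /=.
  by rewrite hstep// heta M_eq0 invr0 scale0r subr0 mulr0 subr0 mul1r.
have M_gt0 : 0 < M by rewrite lt_neqAle eq_sym M_neq0.
pose G := @good_sketch R d l A (3 / 4 * M) xstar.
have GE : [set w | G (x t w, S t w)] `<=` E.
  move=> w [/= hK]; rewrite -(gradE hquad hmu hsc hxstar) => hg.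
  rewrite /E /= hstep// heta.
  exact: (sketched_step_descent hquad hmu hsc xstar hnoise halpha M_gt0 hK hg).
have mG : measurable G := @good_sketch_measurable R d l A (3 / 4 * M) xstar.
have mGw : measurable [set w | G (x t w, S t w)].
  exact: (measurable_preimage (measurable_fun_pair mx mS) mG).
apply: (le_trans _ (le_measure P _ _ GE)); rewrite ?inE//.
apply: (independent_sections mx mS) => //.
  by move=> U V mU mV; rewrite setIC hindep// muleC.
move=> y; have [B hBy] := @sketch_quality R d l _ k (y - xstar) QT hk.
rewrite QQ in hBy.
apply: le_trans (hB B) _; apply: le_measure; rewrite ?inE.
- exact: (measurable_preimage mS (spectral_le_measurable B _)).
- have mGy : measurable [set s : borelM R d l | G (y, s)].
    exact: (measurable_preimage (pair1_measurable (y : borelM R d 1)) mG).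
  exact: (measurable_preimage mS mGy).
- by move=> w /= /hBy.
Qed.
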